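(* Let $\mathbf A$ be a finite nilpotent algebra with a Malcev term. Then $\mathrm{nuP}_{\mathbf A}\subseteq\mathsf{CC}^0$.
   Context: A finite algebra has finite universe and finitely many basic operations. An $n$-ary circuit over $\mathbf A$ is a DAG with one output node, sources labelled by variables or constants from $A$, gates labelled by basic operations; size is nodes plus edges. A NuDFA over $\mathbf A$ is $(\{t_n\}_{n\ge1},\iota,S)$ with $t_n$ an $n$-ary circuit, $\iota:\{0,1\}\to A$, $S\subseteq A$, accepting $b\in\{0,1\}^n$ iff $t_n(\iota(b_1),\dots,\iota(b_n))\in S$; polynomial size means size of $t_n$ polynomial in $n$; $\mathrm{nuP}_{\mathbf A}$ is the class of languages over $\{0,1\}$ accepted by polynomial-size NuDFAs over $\mathbf A$. A Malcev term is a ternary term $d$ with $d(x,y,y)=d(y,y,x)=x$; nilpotency is in the sense of commutator theory. $\mathsf{CC}^0$ is the class of languages recognized by families of polynomial-size constant-depth circuits built from $\mathrm{MOD}_m$ gates of unbounded fan-in for some fixed $m$, where a $\mathrm{MOD}_m$ gate with accepting set $T\subseteq\mathbb Z_m$ outputs 1 iff the sum of its Boolean inputs modulo $m$ lies in $T$. *)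

(* Defs.v *)
From HB Require Import structures.
From mathcomp Require Import all_boot.
Set Implicit Arguments. Unset Strict Implicit. Unset Printing Implicit Defensive.

Record finAlgebra := FinAlgebra {
  carrier : finType;
  opsym : finType;
  arity : opsym -> nat;
  op : forall s : opsym, ('I_(arity s) -> carrier) -> carrier }.
Arguments arity {f} s.
Arguments op {f} s _.

Section Algebra.
Variable A : finAlgebra.
Local Notation U := (carrier A).

Inductive term (n : nat) : Type :=
| Var : 'I_n -> term n
| App : forall s : opsym A, ('I_(arity s) -> term n) -> term n.

Fixpoint term_eval n (t : term n) (x : 'I_n -> U) : U :=
  match t with
  | Var i => x i
  | App s f => op s (fun j => term_eval (f j) x)
  end.

Definition has_malcev_term : Prop :=
  exists d : term 3, forall x y : U,
    term_eval d (fun i : 'I_3 => nth x [:: x; y; y] i) = x /\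
    term_eval d (fun i : 'I_3 => nth x [:: y; y; x] i) = x.

Definition is_congruence (th : U -> U -> Prop) : Prop :=
  (forall x, th x x) /\ (forall x y, th x y -> th y x) /\
  (forall x y z, th x y -> th y z -> th x z) /\
  (forall s (x y : 'I_(arity s) -> U),
      (forall j, th (x j) (y j)) -> th (op s x) (op s y)).

Definition total_rel : U -> U -> Prop := fun _ _ => True.

Definition join_tuple m n (a : 'I_m -> U) (c : 'I_n -> U) : 'I_(m + n) -> U :=
  fun k => match split k with inl i => a i | inr j => c j end.

Definition centralizes (alpha beta delta : U -> U -> Prop) : Prop :=
  forall m n (t : term (m + n)) (a b : 'I_m -> U) (c d : 'I_n -> U),
    (forall i, alpha (a i) (b i)) -> (forall j, beta (c j) (d j)) ->
    delta (term_eval t (join_tuple a c)) (term_eval t (join_tuple a d)) ->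
    delta (term_eval t (join_tuple b c)) (term_eval t (join_tuple b d)).

Definition commutator (alpha beta : U -> U -> Prop) : U -> U -> Prop :=
  fun x y => forall delta, is_congruence delta -> centralizes alpha beta delta ->
    delta x y.

Fixpoint lower_central (k : nat) : U -> U -> Prop :=
  match k with
  | 0 => total_rel
  | k'.+1 => commutator total_rel (lower_central k')
  end.

Definition nilpotent : Prop :=
  exists k, forall x y, lower_central k x y <-> x = y.

(** * Circuits over A.  A circuit is a list of nodes in topological order;
    node k may only refer to nodes j < k; the output is the last node.
    Size = number of nodes + number of edges. *)
Inductive anode : Type :=
| AVar : nat -> anode                     (* input variable x_i (0-based) *)
| AConst : U -> anode
| AGate : forall s : opsym A, ('I_(arity s) -> nat) -> anode.

Definition anode_ok (n k : nat) (nd : anode) : Prop :=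
  match nd with
  | AVar i => i < n
  | AConst _ => True
  | AGate s args => forall j, args j < k
  end.

Definition acircuit_wf (n : nat) (c : seq anode) : Prop :=
  0 < size c /\ forall k, k < size c -> anode_ok n k (nth (AVar 0) c k).

Definition anode_fanin (nd : anode) : nat :=
  match nd with AGate s _ => arity s | _ => 0 end.

Definition acircuit_size (c : seq anode) : nat := size c + sumn (map anode_fanin c).

Definition anode_val (a0 : U) (x : seq U) (vals : seq U) (nd : anode) : U :=
  match nd with
  | AVar i => nth a0 x i
  | AConst a => a
  | AGate s args => op s (fun j => nth a0 vals (args j))
  end.

(** Value of the output node (the default a0 is irrelevant for
    well-formed circuits). *)
Definition acircuit_eval (a0 : U) (c : seq anode) (x : seq U) : U :=
  last a0 (foldl (fun vals nd => rcons vals (anode_val a0 x vals nd)) [::] c).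

(** nuP_A: languages accepted by polynomial-size NuDFAs over A.
    Acceptance is only defined for words of length n >= 1. *)
Definition nuP (L : seq bool -> Prop) : Prop :=
  exists (t : nat -> seq anode) (iota : bool -> U) (S : {set U}),
    (forall n, 0 < n -> acircuit_wf n (t n)) /\
    (exists c k, forall n, 0 < n -> acircuit_size (t n) <= c * n ^ k + c) /\
    (forall b : seq bool,
       L b <-> (0 < size b /\ acircuit_eval (iota false) (t (size b)) (map iota b) \in S)).

End Algebra.

Inductive mnode : Type :=
| MIn : nat -> mnode                      (* Boolean input x_i (0-based) *)
| MGate : seq nat -> seq nat -> mnode.    (* MOD_m gate: accepting residues T, input wires *)

Definition mnode_ok (n k : nat) (nd : mnode) : Prop :=
  match nd with
  | MIn i => i < n
  | MGate _ args => all (fun j => j < k) args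
  end.

Definition mcircuit_wf (n : nat) (c : seq mnode) : Prop :=
  0 < size c /\ forall k, k < size c -> mnode_ok n k (nth (MIn 0) c k).

Definition mnode_fanin (nd : mnode) : nat :=
  match nd with MIn _ => 0 | MGate _ args => size args end.

Definition mcircuit_size (c : seq mnode) : nat := size c + sumn (map mnode_fanin c).

Definition mnode_val (m : nat) (x : seq bool) (vals : seq bool) (nd : mnode) : bool :=
  match nd with
  | MIn i => nth false x i
  | MGate T args => (count id (map (fun j => nth false vals j) args) %% m) \in T
  end.

Definition mcircuit_eval (m : nat) (c : seq mnode) (x : seq bool) : bool :=
  last false (foldl (fun vals nd => rcons vals (mnode_val m x vals nd)) [::] c).

Definition mnode_depth (ds : seq nat) (nd : mnode) : nat :=
  match nd with
  | MIn _ => 0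
  | MGate _ args => (foldr maxn 0 (map (fun j => nth 0 ds j) args)).+1
  end.

Definition mcircuit_depth (c : seq mnode) : nat :=
  foldr maxn 0 (foldl (fun ds nd => rcons ds (mnode_depth ds nd)) [::] c).

Definition CC0 (L : seq bool -> Prop) : Prop :=
  exists m : nat, 0 < m /\
  exists (C : nat -> seq mnode) (d c k : nat),
    (forall n, mcircuit_wf n (C n)) /\
    (forall n, mcircuit_size (C n) <= c * n ^ k + c) /\
    (forall n, mcircuit_depth (C n) <= d) /\
    (forall b : seq bool, L b <-> mcircuit_eval m (C (size b)) b = true).

(* Main.v *)
(** Climb down the lower central series.  If th is a congruence and th is
    central modulo a smaller congruence de, then the differences d(x, y, o) of
    th-related elements, taken modulo de, form a finite abelian group G, and
    every basic operation acts additively on differences.  Hence, for a circuit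
    over A, the offset in G of a node value from a fixed representative of its
    th-class is a sum, over the gates v of the circuit, of terms that depend only
    on the th-classes of the inputs of v; the coefficients of the sum depend on
    the circuit but not on its input word.  So if the th-classes of all nodes
    are computed by modular circuits of bounded depth, a sum in G of polynomially
    many terms, each a function of boundedly many bits, yields the de-classes in
    four more layers.  After as many rounds as the nilpotency class, the values
    themselves are known.  The depth of the circuit over A plays no role.  The
    modulus m is a factorial: it is divisible by the order of every G that occurs
    and so large that a single MOD_m gate computes any Boolean function of the
    boundedly many bits needed at a time. *)

From HB Require Import structures.
From mathcomp Require Import all_boot all_algebra all_fingroup cyclic.
From mathcomp Require Import boolp zify.
Require Import Defs.

Set Implicit Arguments.
Unset Strict Implicit.
Unset Printing Implicit Defensive.

Import GRing.Theory.

(** * Modular circuits *)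

Section RunCircuit.
Variables (N R : Type) (h : seq R -> N -> R).

Definition run (C : seq N) : seq R := foldl (fun acc nd => rcons acc (h acc nd)) [::] C.

Lemma run_rcons C nd : run (rcons C nd) = rcons (run C) (h (run C) nd).
Proof. exact: foldl_rcons. Qed.

Lemma size_run C : size (run C) = size C.
Proof. by elim/last_ind: C => // C nd IH; rewrite run_rcons !size_rcons IH. Qed.

Lemma nth_run r0 n0 C k : k < size C ->
  nth r0 (run C) k = h (take k (run C)) (nth n0 C k).
Proof.
elim/last_ind: C => // C nd IH; rewrite size_rcons ltnS leq_eqVlt run_rcons.
have szC := size_run C.
case/orP=> [/eqP ->|kC]; last first.
  by rewrite !nth_rcons -cats1 takel_cat ?szC ?kC ?IH // ltnW.
by rewrite !nth_rcons szC ltnn eqxx -cats1 take_size_cat.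
Qed.

(** Holds because [f] redirects wires so that a node ignores the prefix. Keeping [h] arbitrary lets
    one argument serve both values and depths. *)
Lemma run_cat (f : N -> N) C1 C2 :
  (forall acc nd, h (run C1 ++ acc) (f nd) = h acc nd) ->
  run (C1 ++ map f C2) = run C1 ++ run C2.
Proof.
move=> hf; elim/last_ind: C2 => [|C2 nd IH]; first by rewrite !cats0.
by rewrite map_rcons -rcons_cat !run_rcons IH hf rcons_cat.
Qed.

End RunCircuit.

Section Computable.
Variables m n : nat.

(* The successor makes the bound multiplicative under composition of gates. *)
Definition computable (d s : nat) (f : seq bool -> bool) : Prop :=
  exists C, [/\ mcircuit_wf n C, mcircuit_size C < s, mcircuit_depth C <= d
    & forall x, size x = n -> mcircuit_eval m C x = f x].

Definition shift_node k (nd : mnode) : mnode :=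
  match nd with
  | MIn i => MIn i
  | MGate T args => MGate T (map (addn k) args)
  end.

Lemma map_nth_shift (R : Type) (r0 : R) (s1 s2 : seq R) args :
  map (nth r0 (s1 ++ s2)) (map (addn (size s1)) args) = map (nth r0 s2) args.
Proof.
rewrite -map_comp; apply: eq_map => j /=.
by rewrite nth_cat ltnNge leq_addr addKn.
Qed.

Lemma mnode_val_shift x (s1 s2 : seq bool) nd :
  mnode_val m x (s1 ++ s2) (shift_node (size s1) nd) = mnode_val m x s2 nd.
Proof. by case: nd => //= T args; rewrite map_nth_shift. Qed.

Lemma mnode_depth_shift (s1 s2 : seq nat) nd :
  mnode_depth (s1 ++ s2) (shift_node (size s1) nd) = mnode_depth s2 nd.
Proof. by case: nd => //= T args; rewrite map_nth_shift. Qed.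

Lemma run_val_cat x C1 C2 :
  run (mnode_val m x) (C1 ++ map (shift_node (size C1)) C2) =
  run (mnode_val m x) C1 ++ run (mnode_val m x) C2.
Proof.
by apply: run_cat => acc nd; rewrite -(size_run (mnode_val m x) C1) mnode_val_shift.
Qed.

Lemma run_depth_cat C1 C2 :
  run mnode_depth (C1 ++ map (shift_node (size C1)) C2) =
  run mnode_depth C1 ++ run mnode_depth C2.
Proof.
by apply: run_cat => acc nd; rewrite -(size_run mnode_depth C1) mnode_depth_shift.
Qed.

Lemma mcircuit_size_cat C1 C2 :
  mcircuit_size (C1 ++ map (shift_node (size C1)) C2) =
  mcircuit_size C1 + mcircuit_size C2.
Proof.
rewrite /mcircuit_size size_cat size_map map_cat sumn_cat addnACA; congr (_ + (_ + _)).
by rewrite -map_comp; congr sumn; apply: eq_map => -[] //= T args; rewrite size_map.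
Qed.

Lemma mnode_ok_shift k l nd : mnode_ok n l nd -> mnode_ok n (k + l) (shift_node k nd).
Proof.
case: nd => //= T args; rewrite all_map => /allP ok; apply/allP => j /ok /=.
by rewrite ltn_add2l.
Qed.

Lemma computable_leq d d' s s' f :
  d <= d' -> s <= s' -> computable d s f -> computable d' s' f.
Proof.
move=> dd ss [C [wf sz dp ev]]; exists C; split=> //.
  exact: leq_trans ss.
exact: leq_trans dd.
Qed.

Lemma eq_computable d s f g :
  (forall x, size x = n -> f x = g x) -> computable d s f -> computable d s g.
Proof.
by move=> fg [C [wf sz dp ev]]; exists C; split=> // x sx; rewrite ev // fg.
Qed.

Lemma computable_input i : i < n -> computable 0 2 (fun x => nth false x i).
Proof.
by move=> i_n; exists [:: MIn i]; split=> //; split=> // -[].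
Qed.

Lemma foldr_maxn_leq (s : seq nat) d : (foldr maxn 0 s <= d) = all (fun e => e <= d) s.
Proof. by elim: s => //= e s IH; rewrite geq_max IH. Qed.

(** The circuits are juxtaposed with shifted wires. Each has size at most [s - 1]; the unit saved
    per circuit, recorded as [size r] on the left, pays for its wire into a gate on top. *)
Lemma computable_parallel (I : eqType) (E : I -> seq bool -> bool) (r : seq I) d s :
  (forall i, i \in r -> computable d s (E i)) ->
  exists C args,
  [/\ forall k, k < size C -> mnode_ok n k (nth (MIn 0) C k),
      all (fun j => j < size C) args,
      mcircuit_size C + size r <= size r * s,
      mcircuit_depth C <= d
    & forall x, size x = n ->
        map (nth false (run (mnode_val m x) C)) args = map (fun i => E i x) r].
Proof.
elim: r => [|i r IH] rE; first by exists [::], [::].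
have [j jr|C2 [args [ok2 lt2 sz2 dp2 ev2]]] := IH.
  by apply: rE; rewrite inE jr orbT.
have [C1 [[C1_gt0 ok1] sz1 dp1 ev1]] := rE i (mem_head i r).
exists (C1 ++ map (shift_node (size C1)) C2), ((size C1).-1 :: map (addn (size C1)) args).
split.
- move=> k; rewrite size_cat size_map nth_cat => kC.
  case: ltnP => [/ok1 //|C1k]; rewrite (nth_map (MIn 0)) ?ltn_subLR //.
  by rewrite -{1}(subnKC C1k); apply/mnode_ok_shift/ok2; rewrite ltn_subLR.
- rewrite /= size_cat size_map (leq_trans (n := size C1)) ?leq_addr ?prednK //=.
  by rewrite all_map; apply: sub_all lt2 => j /=; rewrite ltn_add2l.
- by rewrite mcircuit_size_cat /= mulSn; move: sz1 sz2; lia.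
- rewrite /mcircuit_depth -/(run _ _) run_depth_cat foldr_maxn_leq all_cat -!foldr_maxn_leq.
  by apply/andP.
- move=> x sx; rewrite run_val_cat /=; congr (_ :: _).
    rewrite nth_cat size_run prednK // leqnn -ev1 // /mcircuit_eval.
    by rewrite -/(run _ _) -(nth_last) size_run.
  by rewrite -ev2 // -(size_run (mnode_val m x) C1) map_nth_shift.
Qed.

Lemma computable_gate (I : eqType) (E : I -> seq bool -> bool) (r : seq I) (T : seq nat) d s :
  0 < s -> (forall i, i \in r -> computable d s (E i)) ->
  computable d.+1 ((size r).+2 * s) (fun x => count (fun i => E i x) r %% m \in T).
Proof.
move=> s_gt0 /computable_parallel [C [args [ok lt sz dp ev]]].
(* The length of [args] is visible only through values, and any word of length [n] reveals it. *)
have szargs : size args = size r.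
  have /(congr1 size) := ev (nseq n false) (size_nseq n false).
  by rewrite !size_map.
exists (rcons C (MGate T args)); split.
- split=> [|k]; first by rewrite size_rcons.
  rewrite size_rcons ltnS leq_eqVlt nth_rcons => /orP[/eqP ->|kC].
    by rewrite ltnn eqxx.
  by rewrite kC; apply: ok.
- rewrite /mcircuit_size size_rcons map_rcons sumn_rcons /= szargs.
  by move: sz; rewrite /mcircuit_size !mulSn; lia.
- rewrite /mcircuit_depth -/(run _ _) run_rcons foldr_maxn_leq all_rcons -foldr_maxn_leq.
  rewrite (leq_trans dp) // andbT /= ltnS foldr_maxn_leq all_map.
  move: dp; rewrite /mcircuit_depth foldr_maxn_leq -/(run _ _) => /allP dp.
  apply/allP => j /(allP lt) jC /=; apply: dp; apply: mem_nth.
  by rewrite size_run.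
- move=> x sx; rewrite /mcircuit_eval -/(run _ _) run_rcons last_rcons /=.
  by rewrite ev // count_map.
Qed.

(** * Functions of boundedly many bits and sums in finite abelian groups *)

Fixpoint binary_weighted (I : Type) (r : seq I) : seq I :=
  if r is i :: r' then i :: binary_weighted r' ++ binary_weighted r' else [::].

Lemma size_binary_weighted (I : Type) (r : seq I) :
  (size (binary_weighted r)).+1 = 2 ^ size r.
Proof.
by elim: r => //= i r IH; rewrite size_cat expnS mul2n -addnn -IH addSn addnS.
Qed.

(** The entry at position k of [r] contributes 2^k copies, so a count has the truth values as binary
    digits. Parity gives the head; halving leaves the tail. *)
Lemma count_binary_weighted (I : eqType) (a b : pred I) (r : seq I) :
  count a (binary_weighted r) = count b (binary_weighted r) -> {in r, a =1 b}.
Proof.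
elim: r => //= i r IH; rewrite !count_cat !addnn => eqc.
have ab : a i = b i.
  by move/(congr1 odd): eqc; rewrite !oddD !odd_double !addbF !oddb.
have {}IH : {in r, a =1 b}.
  by apply: IH; move: eqc; rewrite ab => /addnI /double_inj.
by move=> j; rewrite inE => /orP[/eqP ->|/IH].
Qed.

Variable Q : nat.
Hypothesis m_big : 2 ^ Q <= m.

Definition blowup := (2 ^ Q).+1.

(* Weighting the bits by distinct powers of two makes their weighted sum modulo
   m determine them, so one gate computes any function of Q bits. *)
Lemma computable_of_bits (I : finType) (E : I -> seq bool -> bool) F d s :
  #|I| <= Q -> 0 < s -> (forall i, computable d s (E i)) ->
  (forall x y, size x = n -> size y = n -> (forall i, E i x = E i y) -> F x = F y) ->
  computable d.+1 (blowup * s) F.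
Proof.
move=> IQ s_gt0 Ecomp Fdet; pose r := binary_weighted (enum I).
have szr : (size r).+1 <= 2 ^ Q.
  by rewrite size_binary_weighted -cardE leq_exp2l.
pose code x := count (fun i => E i x) r.
have code_lt x : code x < m.
  by apply: leq_trans m_big; apply: leq_ltn_trans szr; apply: count_size.
(* [T] lists the codes of the accepted words. A code determines the bits and these determine [F], so
   no rejected word has its code in [T]. *)
pose T := [seq code (tval x) | x <- [seq y : n.-tuple bool <- enum {: n.-tuple bool} | F y]].
have le_s : (size r).+2 * s <= blowup * s by rewrite leq_mul2r ltnS szr orbT.
apply: (computable_leq (leqnn _) le_s).
have := computable_gate T s_gt0 (fun i (_ : i \in r) => Ecomp i).
apply: eq_computable => x sx; rewrite modn_small; last exact: code_lt.
apply/mapP/idP => [[y]|Fx].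
  rewrite mem_filter => /andP[Fy _] eqc.
  rewrite (Fdet x y) ?size_tuple // => i.
  by apply: (count_binary_weighted eqc); rewrite mem_enum.
have xn : size x == n by apply/eqP.
by exists (Tuple xn) => //; rewrite mem_filter mem_enum /= Fx.
Qed.

Local Open Scope ring_scope.

Lemma mulrn_card_finZmod (G : finZmodType) (g : G) : g *+ #|G| = 0.
Proof. by have := expg_cardG (in_setT g); rewrite cardsT. Qed.

(** Equal summands are collected; by Lagrange's theorem their multiplicities matter only modulo the
    group order. *)
Lemma sum_count_finZmod (G : finZmodType) (I : Type) (r : seq I) (g : I -> G) :
  \sum_(i <- r) g i = \sum_(h : G) h *+ (count (fun i => g i == h) r %% #|G|).
Proof.
have modE (h : G) k : h *+ (k %% #|G|) = h *+ k.
  by rewrite [in RHS](divn_eq k #|G|) mulrnDr mulnC mulrnA mulrn_card_finZmod mul0rn add0r.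
transitivity (\sum_(h : G) h *+ (count (fun i => g i == h) r)); last first.
  by apply: eq_bigr => h _; rewrite modE.
elim: r => [|i r IH]; first by rewrite big_nil big1.
rewrite big_cons IH /=; under [RHS]eq_bigr do rewrite mulrnDr.
rewrite big_split /=; congr (_ + _).
by rewrite (bigD1 (g i)) //= eqxx big1 ?addr0 // => h; rewrite eq_sym => /negPf ->.
Qed.

(** A first layer finds, for each group element, how many summands equal it modulo the order of [G];
    MOD_m gates can do so since the order divides [m]. One more gate combines these bits, whose
    number is the square of the order. *)
Lemma computable_sum (G : finZmodType) (I : eqType) (r : seq I)
    (g : I -> seq bool -> G) d s :
  (0 < s)%N -> (#|G| %| m)%N -> (#|G| * #|G| <= Q)%N ->
  (forall i h, i \in r -> computable d s (fun x => g i x == h)) ->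
  forall h, computable d.+2 (blowup * ((size r).+2 * s))
    (fun x => \sum_(i <- r) g i x == h).
Proof.
move=> s_gt0 Gm GQ gc h.
pose c x h := (count (fun i => g i x == h) r %% #|G|)%N.
pose E (p : G * 'I_#|G|) x := c x p.1 == p.2.
apply: (@computable_of_bits _ E); rewrite ?card_prod ?card_ord ?muln_gt0 //.
- case=> k e.
  have := @computable_gate _ (fun i x => g i x == k) r
    [seq t <- iota 0 m | t %% #|G| == e]%N d s s_gt0 (fun i => gc i k).
  apply: eq_computable => x _; rewrite mem_filter mem_iota modn_dvdm //=.
  rewrite ltn_mod andb_idr // => _.
  by apply: leq_trans m_big; rewrite expn_gt0.
- move=> x y _ _ eqE; rewrite (sum_count_finZmod r (g^~ x)) (sum_count_finZmod r (g^~ y)).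
  congr (_ == _).
  apply: eq_bigr => k _; congr (_ *+ _).
  have lt : (c x k < #|G|)%N by rewrite ltn_mod; apply/card_gt0P; exists k.
  by have := eqE (k, Ordinal lt); rewrite /E eqxx => /esym/eqP /esym.
Qed.

End Computable.

(** * Central congruences of a Malcev algebra *)

Section TermOperations.
Variable A : finAlgebra.
Local Notation U := (carrier A).

Lemma congruence_term_eval (th : U -> U -> Prop) n (t : term A n) (x y : 'I_n -> U) :
  is_congruence th -> (forall i, th (x i) (y i)) ->
  th (term_eval t x) (term_eval t y).
Proof.
move=> [_ [_ [_ th_op]]] xy; elim: t => [i|s f IH] //=.
exact: th_op.
Qed.

Lemma join_tuple_lshift m n (a : 'I_m -> U) (c : 'I_n -> U) i :
  join_tuple a c (lshift n i) = a i.
Proof. by rewrite /join_tuple (unsplitK (inl i)). Qed.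

Lemma join_tuple_rshift m n (a : 'I_m -> U) (c : 'I_n -> U) j :
  join_tuple a c (rshift m j) = c j.
Proof. by rewrite /join_tuple (unsplitK (inr j)). Qed.

(** The two blocks of variables match those of [centralizes]; with functions in place of syntax, no
    substitution has to be written out. *)
Definition term_definable m n (f : ('I_m -> U) -> ('I_n -> U) -> U) : Prop :=
  exists t : term A (m + n), forall a c, term_eval t (join_tuple a c) = f a c.

Lemma definable_left m n (i : 'I_m) :
  term_definable (fun a (_ : 'I_n -> U) => a i).
Proof. by exists (Var A (lshift n i)) => a c /=; rewrite join_tuple_lshift. Qed.

Lemma definable_right m n (j : 'I_n) :
  term_definable (fun (_ : 'I_m -> U) c => c j).
Proof. by exists (Var A (rshift m j)) => a c /=; rewrite join_tuple_rshift. Qed.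

Lemma definable_term m n k (t : term A k) (f : 'I_k -> ('I_m -> U) -> ('I_n -> U) -> U) :
  (forall i, term_definable (f i)) ->
  term_definable (fun a c => term_eval t (fun i => f i a c)).
Proof.
move=> ft; elim: t => [i|s g IH] /=; first exact: ft.
have [h hE] := choice IH.
exists (App h) => a c /=; congr op; apply: funext => j; exact: hE.
Qed.

End TermOperations.

Section CentralCongruence.
Variables (A : finAlgebra) (d : term A 3) (o : carrier A).
Local Notation U := (carrier A).
Hypothesis malcev : forall x y : U,
  term_eval d (fun i : 'I_3 => nth x [:: x; y; y] i) = x /\
  term_eval d (fun i : 'I_3 => nth x [:: y; y; x] i) = x.

Definition malcev_op (x y z : U) : U :=
  term_eval d (fun i : 'I_3 => nth x [:: x; y; z] i).
Local Notation "<| x , y , z |>" := (malcev_op x y z).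

Lemma malcev_right x y : <|x, y, y|> = x.
Proof. exact: (malcev x y).1. Qed.

Lemma malcev_left x y : <|y, y, x|> = x.
Proof.
(* The two tuples differ only in the default of [nth], which no index below 3 reaches. *)
rewrite -[RHS](malcev x y).2 /malcev_op; congr term_eval; apply: funext => i.
exact: set_nth_default.
Qed.

Lemma definable_malcev_op m n (f g h : ('I_m -> U) -> ('I_n -> U) -> U) :
  term_definable f -> term_definable g -> term_definable h ->
  term_definable (fun a c => <|f a c, g a c, h a c|>).
Proof.
move=> ft gt ht.
have [|t tE] := @definable_term A m n 3 d (fun i => nth f [:: f; g; h] i).
  by case=> [[|[|[|]]]].
exists t => a c; rewrite tE; congr term_eval; apply: funext.
by case=> [[|[|[|]]]].
Qed.

Variables th de : U -> U -> Prop.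
Hypotheses (th_cong : is_congruence th) (de_cong : is_congruence de).
Hypothesis de_th : forall x y, de x y -> th x y.
Hypothesis central : centralizes (@total_rel A) th de.

Let th_refl x : th x x. Proof. exact: th_cong.1. Qed.
Let th_sym x y : th x y -> th y x. Proof. exact: th_cong.2.1. Qed.
Let th_trans y x z : th x y -> th y z -> th x z. Proof. exact: th_cong.2.2.1. Qed.
Let de_refl x : de x x. Proof. exact: de_cong.1. Qed.
Let de_sym x y : de x y -> de y x. Proof. exact: de_cong.2.1. Qed.
Let de_trans y x z : de x y -> de y z -> de x z. Proof. exact: de_cong.2.2.1. Qed.

Lemma congruence_malcev_op (r : U -> U -> Prop) x y z x' y' z' :
  is_congruence r -> r x x' -> r y y' -> r z z' -> r <|x, y, z|> <|x', y', z'|>.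
Proof.
by move=> rc xx yy zz; apply: congruence_term_eval => //; case=> [[|[|[|]]]].
Qed.

(* The two sides agree when y = z, so they agree up to de when x and y are
   th-related: move the free arguments from z = y to the given z. *)
Lemma central_malcev_term n (p : term A n) (x y z : 'I_n -> U) :
  (forall i, th (x i) (y i)) ->
  de (term_eval p (fun i => <|x i, y i, z i|>))
     <|term_eval p x, term_eval p y, term_eval p z|>.
Proof.
move=> xy.
pose Y (a : 'I_(n + n + 1) -> U) i := a (lshift 1 (lshift n i)).
pose Z (a : 'I_(n + n + 1) -> U) i := a (lshift 1 (rshift n i)).
pose W (a : 'I_(n + n + 1) -> U) := a (rshift (n + n) ord0).
pose q (x y z : 'I_n -> U) := term_eval p (fun i => <|x i, y i, z i|>).
pose q' (x y z : 'I_n -> U) := <|term_eval p x, term_eval p y, term_eval p z|>.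
have Yd i : @term_definable A _ n (fun a _ => Y a i) by exact: definable_left.
have Zd i : @term_definable A _ n (fun a _ => Z a i) by exact: definable_left.
have Xd i : @term_definable A (n + n + 1) n (fun _ c => c i).
  exact: definable_right.
(* With [W] set to [q' x y z]: when [Z] is y, the value is [W] both for c = x and for c = y. When
   [Z] is z, it is [q x y z] for c = x and still [W] for c = y. *)
have [t tE] : @term_definable A _ n
    (fun a c => <|q c (Y a) (Z a), q' c (Y a) (Z a), W a|>).
  apply: definable_malcev_op; last exact: definable_left.
    apply: (@definable_term A _ n n p (fun i a c => <|c i, Y a i, Z a i|>)) => i.
    exact: definable_malcev_op.
  apply: definable_malcev_op.
  - exact: (@definable_term A _ n n p (fun i _ c => c i)).
  - exact: (@definable_term A _ n n p (fun i a _ => Y a i)).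
  - exact: (@definable_term A _ n n p (fun i a _ => Z a i)).
pose mk (u : 'I_n -> U) := join_tuple (join_tuple y u) (fun _ : 'I_1 => q' x y z).
have Ymk u : Y (mk u) = y.
  by apply: funext => i; rewrite /Y /mk !join_tuple_lshift.
have Zmk u : Z (mk u) = u.
  by apply: funext => i; rewrite /Z /mk join_tuple_lshift join_tuple_rshift.
have Wmk u : W (mk u) = q' x y z by rewrite /W /mk join_tuple_rshift.
have qr u : q u y y = term_eval p u.
  by congr term_eval; apply: funext => i; rewrite malcev_right.
have ql u : q y y u = term_eval p u.
  by congr term_eval; apply: funext => i; rewrite malcev_left.
have := central (t := t) (a := mk y) (b := mk z) (c := x) (d := y) (fun _ => I) xy.
have q'r u : q' u y y = term_eval p u by exact: malcev_right.
have q'l u : q' y y u = term_eval p u by exact: malcev_left.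
rewrite !tE !Ymk !Zmk !Wmk !qr !q'r !ql !q'l !malcev_left malcev_right.
by apply; apply: de_refl.
Qed.

(** The Malcev term commutes with itself modulo [de]. Associativity, commutativity and inverses of
    the difference group are instances in which some arguments collapse. *)
Lemma malcev_op_entropic x1 y1 z1 x2 y2 z2 x3 y3 z3 :
  th x1 y1 -> th x2 y2 -> th x3 y3 ->
  de <|<|x1, y1, z1|>, <|x2, y2, z2|>, <|x3, y3, z3|>|>
     <|<|x1, x2, x3|>, <|y1, y2, y3|>, <|z1, z2, z3|>|>.
Proof.
move=> h1 h2 h3.
have := @central_malcev_term 3 d (fun i => nth x1 [:: x1; x2; x3] i)
  (fun i => nth y1 [:: y1; y2; y3] i) (fun i => nth z1 [:: z1; z2; z3] i).
have -> : (fun i : 'I_3 => <|nth x1 [:: x1; x2; x3] i, nth y1 [:: y1; y2; y3] i,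
    nth z1 [:: z1; z2; z3] i|>) = (fun i : 'I_3 => nth <|x1, y1, z1|>
    [:: <|x1, y1, z1|>; <|x2, y2, z2|>; <|x3, y3, z3|>] i).
  by apply: funext; case=> [[|[|[|]]]].
by apply; case=> [[|[|[|]]]].
Qed.

Lemma malcev_op_addition x y z :
  th x y -> th y z -> de <|<|x, y, o|>, o, <|y, z, o|>|> <|x, z, o|>.
Proof.
move=> xy yz; have := malcev_op_entropic o o o xy (th_refl y) yz.
by rewrite !malcev_left !malcev_right.
Qed.

(** Change of base point: a difference formed at [u] can be read at any [w], in particular at
    [o]. *)
Lemma malcev_op_rebase x y u w : th x y -> de <|<|x, y, u|>, u, w|> <|x, y, w|>.
Proof.
move=> xy; have := malcev_op_entropic u u w xy (th_refl y) (th_refl y).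
by rewrite !malcev_left !malcev_right.
Qed.

(** * The abelian group of differences *)

Definition repr (r : U -> U -> Prop) (x : U) : U := odflt x [pick y | `[< r x y >]].

Lemma repr_rel r x : is_congruence r -> r x (repr r x).
Proof.
move=> [r_refl _]; rewrite /repr; case: pickP => [y /asboolP //|/(_ x)].
by move/asboolP: (r_refl x) => ->.
Qed.

(** [pick] depends only on the extension of its predicate, here the class, and never falls back on
    the default since a class is nonempty. *)
Lemma eq_repr r x y : is_congruence r -> r x y -> repr r x = repr r y.
Proof.
move=> [r_refl [r_sym [r_trans _]]] xy; rewrite /repr.
have rE : (fun z => `[< r x z >]) =1 (fun z => `[< r y z >]).
  by move=> z; apply/asboolP/asboolP; apply: r_trans => //; apply: r_sym.
rewrite (eq_pick rE); case: pickP => // /(_ y).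
by move/asboolP: (r_refl y) => ->.
Qed.

Lemma repr_inj r x y : is_congruence r -> repr r x = repr r y -> r x y.
Proof.
move=> rc xy; have [_ [r_sym [r_trans _]]] := rc.
apply: (r_trans _ (repr r x)); first exact: repr_rel.
by rewrite xy; apply: r_sym; apply: repr_rel.
Qed.

(* The de-classes inside the th-class of o, given by representatives, form an
   abelian group under x + y = d(x, o, y). *)
Definition is_difference : pred U :=
  fun x => (repr de x == x) && `[< th x o >].

Definition differences := {x : U | is_difference x}.
HB.instance Definition _ := SubFinite.on differences.

Lemma is_difference_repr x : th x o -> is_difference (repr de x).
Proof.
move=> xo; apply/andP; split.
  by apply/eqP/esym; apply: eq_repr => //; apply: repr_rel.
apply/asboolP; apply: th_trans xo; apply: th_sym; apply: de_th.
exact: repr_rel.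
Qed.

Lemma is_difference_zero : is_difference (repr de o).
Proof. exact: is_difference_repr. Qed.

(** Elements outside the [th]-class of [o] get the class of [o] as a junk value, which makes the map
    total. *)
Definition class_of (x : U) : differences :=
  insubd (Sub (repr de o) is_difference_zero : differences) (repr de x).

Lemma val_class_of x : th x o -> val (class_of x) = repr de x.
Proof. by move=> xo; rewrite val_insubd is_difference_repr. Qed.

Lemma eq_class_of x y : de x y -> class_of x = class_of y.
Proof. by move=> xy; rewrite /class_of (eq_repr de_cong xy). Qed.

Lemma class_of_inj x y : th x o -> th y o -> class_of x = class_of y -> de x y.
Proof.
move=> xo yo /(congr1 val); rewrite !val_class_of //; exact: repr_inj.
Qed.

Lemma val_difference (g : differences) : th (val g) o.
Proof. by case/andP: (valP g) => _ /asboolP. Qed.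

Lemma class_ofK (g : differences) : class_of (val g) = g.
Proof.
apply: val_inj; rewrite val_class_of; last exact: val_difference.
by case/andP: (valP g) => /eqP.
Qed.

Lemma val_class_of_rel x : th x o -> de (val (class_of x)) x.
Proof. by move=> xo; rewrite val_class_of //; apply: de_sym; apply: repr_rel. Qed.

Definition add_diff (g h : differences) : differences :=
  class_of <|val g, o, val h|>.
Definition opp_diff (g : differences) : differences := class_of <|o, val g, o|>.

Lemma th_malcev_op x y z : th x o -> th y o -> th z o -> th <|x, y, z|> o.
Proof.
by move=> xo yo zo; rewrite -[X in th _ X](malcev_right o o); apply: congruence_malcev_op.
Qed.

Lemma add_class_of x y : th x o -> th y o ->
  add_diff (class_of x) (class_of y) = class_of <|x, o, y|>.
Proof.
by move=> xo yo; apply: eq_class_of; apply: congruence_malcev_op => //;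
  apply: val_class_of_rel.
Qed.

Lemma add_diffA : associative add_diff.
Proof.
move=> f g h; rewrite -[f]class_ofK -[g]class_ofK -[h]class_ofK.
move: (val f) (val g) (val h) (val_difference f) (val_difference g)
  (val_difference h) => x y z xo yo zo.
rewrite !add_class_of //; try exact: th_malcev_op.
apply: eq_class_of; apply: de_sym.
have := malcev_op_entropic y o z xo (th_refl o) (th_refl o).
by rewrite !malcev_left !malcev_right.
Qed.

Lemma add_diffC : commutative add_diff.
Proof.
move=> f g; rewrite -[f]class_ofK -[g]class_ofK.
move: (val f) (val g) (val_difference f) (val_difference g) => x y xo yo.
rewrite !add_class_of //; apply: eq_class_of.
have := malcev_op_entropic x o o (th_refl o) (th_refl o) yo.
by rewrite !malcev_left !malcev_right.
Qed.

Lemma add_0diff : left_id (class_of o) add_diff.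
Proof.
move=> f; rewrite -[f]class_ofK add_class_of ?malcev_left //.
exact: val_difference.
Qed.

Lemma add_Ndiff : left_inverse (class_of o) opp_diff add_diff.
Proof.
move=> f; rewrite /opp_diff -{2}[f]class_ofK.
move: (val f) (val_difference f) => x xo.
rewrite add_class_of //; last exact: th_malcev_op.
apply: eq_class_of.
have := malcev_op_entropic o o x (th_sym xo) (th_refl x) (th_refl x).
by rewrite !malcev_left !malcev_right.
Qed.

HB.instance Definition _ :=
  GRing.isZmodule.Build differences add_diffA add_diffC add_0diff add_Ndiff.

Definition diff (x y : U) : differences := class_of <|x, y, o|>.

Lemma th_diff x y : th x y -> th <|x, y, o|> o.
Proof.
move=> xy; rewrite -[X in th _ X](malcev_left o y); exact: congruence_malcev_op.
Qed.

Local Open Scope ring_scope.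

Lemma diffD x y z : th x y -> th y z -> diff x y + diff y z = diff x z.
Proof.
move=> xy yz; rewrite [LHS]add_class_of; try exact: th_diff.
by apply: eq_class_of; apply: malcev_op_addition.
Qed.

(** Moving the base point from [o] to [y] turns the difference back into [x]; a zero difference,
    moved the same way, yields [y]. *)
Lemma diff_eq0 x y : th x y -> diff x y = 0 -> de x y.
Proof.
move=> xy eq0; have h := class_of_inj (th_diff xy) (th_refl o) eq0.
have := @congruence_malcev_op de <|x, y, o|> o y o o y de_cong h (de_refl o) (de_refl y).
rewrite malcev_left => h'; apply: de_trans h'; apply: de_sym.
by have := malcev_op_rebase o y xy; rewrite malcev_right.
Qed.

(** The linear part of an operation: subtracting the value at the constant tuple [o] removes the
    constant term, as [o] may fail to be idempotent. *)
Definition op_diff (s : opsym A) (g : 'I_(arity s) -> differences) : differences :=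
  diff (op s (fun j => val (g j))) (op s (fun=> o)).

Let op_central s (x y z : 'I_(arity s) -> U) : (forall j, th (x j) (y j)) ->
  de (op s (fun j => <|x j, y j, z j|>)) <|op s x, op s y, op s z|>.
Proof. exact: (@central_malcev_term _ (App (@Var A _))). Qed.

Let th_op s (x y : 'I_(arity s) -> U) :
  (forall j, th (x j) (y j)) -> th (op s x) (op s y).
Proof. exact: th_cong.2.2.2. Qed.

Let de_op s (x y : 'I_(arity s) -> U) :
  (forall j, de (x j) (y j)) -> de (op s x) (op s y).
Proof. exact: de_cong.2.2.2. Qed.

(** The path from [g + h] through [h] to the constant tuple [o] splits the difference. Its first leg
    is the difference from [g] to [o] at another base point, by centrality and
    [malcev_op_rebase]. *)
Lemma op_diffD s (g h : 'I_(arity s) -> differences) :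
  op_diff (fun j => g j + h j) = op_diff g + op_diff h.
Proof.
have g0 j : th (val (g j)) o by exact: val_difference.
have h0 j : th (val (h j)) o by exact: val_difference.
have gh0 j : th (val (g j + h j)) o by exact: val_difference.
have gh j : th (val (g j + h j)) (val (h j)) by apply: th_trans (th_sym (h0 j)).
rewrite /op_diff -(@diffD _ (op s (fun j => val (h j)))); try exact: th_op.
suff -> : diff (op s (fun j => val (g j + h j))) (op s (fun j => val (h j))) =
    diff (op s (fun j => val (g j))) (op s (fun=> o)) by [].
apply: (@eq_class_of); apply: (de_trans (y := <|<|op s (fun j => val (g j)), op s (fun=> o),
  op s (fun j => val (h j))|>, op s (fun j => val (h j)), o|>)); last first.
  by apply: malcev_op_rebase; apply: th_op.
apply: congruence_malcev_op => //; apply: de_trans (op_central _ g0).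
apply: de_op => j; apply: val_class_of_rel.
exact: th_malcev_op.
Qed.

Lemma diff_op s (x y : 'I_(arity s) -> U) : (forall j, th (x j) (y j)) ->
  diff (op s x) (op s y) = op_diff (fun j => diff (x j) (y j)).
Proof.
move=> xy; apply: eq_class_of; apply: de_sym.
apply: (de_trans (y := <|<|op s x, op s y, op s (fun=> o)|>, op s (fun=> o), o|>));
  last by apply: malcev_op_rebase; apply: th_op.
apply: congruence_malcev_op => //; apply: de_trans (op_central _ xy).
by apply: de_op => j; apply: val_class_of_rel; apply: th_diff.
Qed.

Lemma card_differences : (#|{: differences}| <= #|U|)%N.
Proof. by rewrite card_sub max_card. Qed.

Lemma central_difference_group :
  exists (G : finZmodType) (D : U -> U -> G)
         (F : forall s : opsym A, ('I_(arity s) -> G) -> G),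
  [/\ (#|G| <= #|U|)%N,
      forall x y z, th x y -> th y z -> D x y + D y z = D x z,
      forall x y, th x y -> D x y = 0 -> de x y,
      forall s g h, F s (fun j => g j + h j) = F s g + F s h
    & forall s x y, (forall j, th (x j) (y j)) ->
        D (op s x) (op s y) = F s (fun j => D (x j) (y j))].
Proof.
exists differences, diff, op_diff; split.
- exact: card_differences.
- exact: diffD.
- exact: diff_eq0.
- exact: op_diffD.
- exact: diff_op.
Qed.

End CentralCongruence.

(** * Circuits over a nilpotent algebra *)

Section LowerCentralSeries.
Variable A : finAlgebra.
Local Notation U := (carrier A).

Lemma commutator_congruence (al be : U -> U -> Prop) : is_congruence (commutator al be).
Proof.
split=> [x de [] //|]; split=> [x y xy de de_cong dc|].
  by apply: de_cong.2.1; apply: xy.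
split=> [x y z xy yz de de_cong dc|s x y xy de de_cong dc].
  by apply: (de_cong.2.2.1 _ y); [apply: xy | apply: yz].
by apply: de_cong.2.2.2 => j; apply: xy.
Qed.

(** Both the premise and the conclusion of centrality pass to the intersection of all admissible
    congruences. *)
Lemma centralizes_commutator (al be : U -> U -> Prop) :
  centralizes al be (commutator al be).
Proof.
move=> m n t a b c d ab cd tacd de de_cong dc.
by apply: (dc m n t a b c d ab cd); apply: tacd.
Qed.

(** [be] is itself admissible in the intersection: changing arguments within [be] changes a term
    value within [be]. *)
Lemma commutator_sub_right (al be : U -> U -> Prop) x y :
  is_congruence be -> commutator al be x y -> be x y.
Proof.
move=> be_cong; apply; first by [].
move=> m n t a b c d _ cd _.
apply: congruence_term_eval => // i; rewrite /join_tuple; case: split => // k.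
exact: be_cong.1.
Qed.

Lemma lower_central_congruence k : is_congruence (@lower_central A k).
Proof. by case: k => [|k]; [|apply: commutator_congruence]. Qed.

End LowerCentralSeries.

(** * Affine recursions along a circuit *)

Section AffineCircuits.
Local Open Scope ring_scope.

Lemma additive_sum (G : zmodType) k (F : ('I_k -> G) -> G) (I : Type) (r : seq I)
    (g : I -> 'I_k -> G) :
  (forall g h, F (fun j => g j + h j) = F g + F h) ->
  F (fun j => \sum_(i <- r) g i j) = \sum_(i <- r) F (g i).
Proof.
move=> FD; elim: r => [|i r IH].
  (* Additivity forces [F] to vanish at zero, by cancellation. *)
  apply: (addrI (F (fun=> 0))); rewrite big_nil addr0.
  have -> : (fun j => \sum_(i <- [::]) g i j) = (fun=> 0).
    by apply: funext => j; rewrite big_nil.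
  by rewrite -FD; congr F; apply: funext => j; rewrite addr0.
rewrite big_cons -IH -FD; congr F.
by apply: funext => j; rewrite big_cons.
Qed.

Variables (A : finAlgebra) (G : zmodType).
Variable F : forall s : opsym A, ('I_(arity s) -> G) -> G.
Arguments F : clear implicits.
Hypothesis FD : forall s g h, F s (fun j => g j + h j) = F s g + F s h.

Definition linear_part (nd : anode A) (g : nat -> G) : G :=
  match nd with AGate s args => F s (fun j => g (args j)) | _ => 0 end.

(** [C] is chosen before [x], so it may be hardwired into a nonuniform circuit. It need only be some
    function of [t x v]: applying it requires no bits beyond those determining [t x v]. *)
Lemma affine_circuit_sum (n : nat) (c : seq (anode A)) (X : Type) (g t : X -> nat -> G) :
  acircuit_wf n c ->
  (forall w x, (w < size c)%N ->
     g x w = linear_part (nth (AVar A 0) c w) (g x) + t x w) ->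
  forall w, (w < size c)%N ->
  exists C : nat -> G -> G, forall x, g x w = \sum_(v <- iota 0 (size c)) C v (t x v).
Proof.
move=> [_ ok] gE; elim/ltn_ind => w IH wc.
(* Unfolding the circuit below w gives an affine function of the constants t;
   the operators C depend on the circuit only, not on x. *)
have single x : t x w = \sum_(v <- iota 0 (size c)) (if v == w then t x v else 0).
  rewrite (bigD1_seq w) ?iota_uniq ?mem_iota //= eqxx big1 ?addr0 //.
  by move=> v /negPf ->.
suff [C CE] : exists C : nat -> G -> G, forall x,
    linear_part (nth (AVar A 0) c w) (g x) = \sum_(v <- iota 0 (size c)) C v (t x v).
  exists (fun v h => C v h + (if v == w then h else 0)) => x.
  by rewrite gE // CE single big_split.
have := ok w wc; case: (nth _ c w) => [i|a|s args] /= lt.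
- by exists (fun _ _ => 0) => x; rewrite big1.
- by exists (fun _ _ => 0) => x; rewrite big1.
have /choice[C CE] j := IH (args j) (lt j) (ltn_trans (lt j) wc).
exists (fun v h => F s (fun j => C j v h)) => x.
rewrite -(additive_sum _ (fun v j => C j v (t x v))) //.
by congr F; apply: funext => j; apply: CE.
Qed.

End AffineCircuits.

(** * One step down the central series, and its iteration *)

Section Levels.
Variables (A : finAlgebra) (io : bool -> carrier A) (n : nat) (c : seq (anode A)).
Local Notation U := (carrier A).
Local Notation o := (io false).
Hypothesis c_wf : acircuit_wf n c.

Definition node_value (x : seq bool) (w : nat) : U :=
  nth o (run (anode_val o (map io x)) c) w.

Lemma node_valueE x w : size x = n -> w < size c ->
  node_value x w = match nth (AVar A 0) c w with
    | AVar i => io (nth false x i)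
    | AConst a => a
    | AGate s args => op s (fun j => node_value x (args j))
    end.
Proof.
move=> sx wc; rewrite /node_value (nth_run _ _ (AVar A 0)) //.
have := c_wf.2 w wc; case: (nth _ c w) => [i|a|s args] //= lt.
  by rewrite (nth_map false) ?sx.
by congr op; apply: funext => j; rewrite nth_take.
Qed.

Variables (m Q : nat).
Hypothesis m_big : 2 ^ Q <= m.
Hypothesis m_dvd : forall e, 0 < e -> e <= #|U| -> e %| m.
Hypothesis arity_le : forall s : opsym A, arity s * #|U| <= Q.
Hypothesis square_le : #|U| * #|U| <= Q.
Hypothesis double_le : #|U| + #|U| <= Q.

Definition classes_computable (th : U -> U -> Prop) d s : Prop :=
  forall w a, w < size c -> computable m n d s (fun x => `[< th (node_value x w) a >]).

Lemma eq_class (th : U -> U -> Prop) u v : is_congruence th ->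
  (forall a, `[< th u a >] = `[< th v a >]) -> th u v.
Proof.
by move=> [th_refl _] uv; apply/asboolP; rewrite uv; apply/asboolP.
Qed.

(** From the inside out: a gate for each constant term, the counting gates over all nodes, the gate
    combining the counts, and the gate for the finer class. *)
Definition level_size s := blowup Q * (blowup Q * ((size c).+2 * (blowup Q * s))).

Lemma classes_computable_step (d : term A 3) (th de : U -> U -> Prop) l s :
  (forall x y : U,
    term_eval d (fun i : 'I_3 => nth x [:: x; y; y] i) = x /\
    term_eval d (fun i : 'I_3 => nth x [:: y; y; x] i) = x) ->
  is_congruence th -> is_congruence de -> (forall x y, de x y -> th x y) ->
  centralizes (@total_rel A) th de -> 1 < s ->
  classes_computable th l s -> classes_computable de l.+4 (level_size s).
Proof.
move=> malcev th_cong de_cong de_th central s_gt1 thc.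
have [G [D [F [cardG DD D0 FD DF]]]] :=
  central_difference_group o malcev th_cong de_cong de_th central.
have s_gt0 : 0 < s by exact: ltnW.
have U_gt0 : 0 < #|U| by apply/card_gt0P; exists o.
have G_gt0 : 0 < #|G| by apply/card_gt0P; exists 0%R.
have [_ [th_sym [th_trans th_op]]] := th_cong.
pose V := node_value; pose R x w := repr th (V x w).
have VR x w : th (V x w) (R x w) by exact: repr_rel.
(* The constant term of the recursion. At a gate it compares the operation on representatives with
   the representative of the result; at inputs and constants the linear part is 0 and it is the
   whole offset. *)
pose t x v := match nth (AVar A 0) c v with
  | AGate s args => D (op s (fun j => R x (args j))) (R x v)
  | _ => D (V x v) (R x v) end.
pose X := {x : seq bool | size x == n}.
have gE w (x : X) : w < size c -> D (V (val x) w) (R (val x) w) =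
    (linear_part F (nth (AVar A 0) c w) (fun v => D (V (val x) v) (R (val x) v))
     + t (val x) w)%R.
  case: x => x /= /eqP sx wc; have := node_valueE sx wc; rewrite /t.
  case: (nth _ c w) => [i|a|f args] /= VE; rewrite ?add0r // -DF // DD -?VE //.
  by rewrite /V VE; apply: th_op.
  apply: th_trans (VR x w); rewrite /V VE; apply: th_op => j; exact: th_sym.
have t_comp (C : nat -> G -> G) v h : v < size c ->
    computable m n l.+1 (blowup Q * s) (fun x => C v (t x v) == h).
  move=> vc; have VE x := @node_valueE x v ^~ vc.
  have := c_wf.2 v vc; rewrite /t; case E: (nth _ c v) => [i|a|f args] /= lt.
  - apply: (@computable_of_bits _ _ Q m_big unit (fun _ x => nth false x i)) => //.
    + by rewrite card_unit (leq_trans U_gt0) // (leq_trans _ double_le) // leq_addr.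
    + by move=> _; apply: computable_leq (computable_input _ lt).
    + by move=> x y sx sy /(_ tt) xy; rewrite /R /V !VE // E xy.
  - apply: (@computable_of_bits _ _ Q m_big void (fun _ _ => false)) => //.
      by rewrite card_void.
    by move=> x y sx sy _; rewrite /R /V !VE // E.
  - apply: (@computable_of_bits _ _ Q m_big ('I_(arity f) * U)%type
      (fun p x => `[< th (V x (args p.1)) p.2 >])) => //.
    + by rewrite card_prod card_ord.
    + by case=> j a; apply: thc; apply: ltn_trans vc.
    + move=> x y sx sy xy.
      have RE j : R x (args j) = R y (args j).
        by apply: eq_repr => //; apply: eq_class => // a; apply: (xy (j, a)).
      (* The class of the gate itself is determined by the argument classes, so it costs no further
         bits. *)
      have RvE z : size z = n -> R z v = repr th (op f (fun j => R z (args j))).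
        move=> sz; apply: eq_repr => //; rewrite /V VE // E.
        by apply: th_op => j; apply: VR.
      by rewrite !RvE //; congr (C v (D _ (repr th _)) == h);
        congr op; apply: funext => j; apply: RE.
have g_comp w h : w < size c -> computable m n l.+3
    (blowup Q * ((size c).+2 * (blowup Q * s))) (fun x => D (V x w) (R x w) == h).
  move=> wc; have [C CE] := affine_circuit_sum FD c_wf gE wc.
  have := @computable_sum m n Q m_big G _ (iota 0 (size c)) (fun v x => C v (t x v)) l.+1
    (blowup Q * s).
  rewrite size_iota => /(_ _ _ _ _ h) sumc.
  apply: (@eq_computable _ _ _ _ (fun x => (\sum_(v <- iota 0 (size c)) C v (t x v))%R == h)).
    by move=> x /eqP sx; rewrite (CE (exist _ x sx)).
  apply: sumc.
  - by rewrite muln_gt0.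
  - exact: m_dvd.
  - by rewrite (leq_trans _ square_le) // leq_mul.
  - by move=> v k; rewrite mem_iota => /andP[_ vc]; apply: t_comp.
move=> w a wc.
apply: (@computable_of_bits _ _ Q m_big (U + G)%type (fun p x => match p with
  | inl b => `[< th (V x w) b >] | inr h => D (V x w) (R x w) == h end)).
- by rewrite card_sum (leq_trans _ double_le) // leq_add2l.
- by rewrite !muln_gt0.
- case=> [b|h]; last exact: g_comp.
  apply: computable_leq (thc w b wc); first by rewrite !leqW.
  by rewrite mulnCA !mulnA leq_pmull // !muln_gt0.
- move=> x y _ _ xy; rewrite -/V.
  have Vxy : th (V x w) (V y w) by apply: eq_class => // b; apply: (xy (inl b)).
  have Rxy : R x w = R y w by exact: eq_repr.
  (* Equal offsets from a common representative cancel, so the difference of the two values is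
     zero. *)
  have de_xy : de (V x w) (V y w).
    apply: D0 => //; apply: (addIr (D (V y w) (R y w))); rewrite add0r DD //.
    have := xy (inr (D (V y w) (R y w))); rewrite /= eqxx -Rxy => /eqP.
    by rewrite Rxy.
  have [_ [de_sym [de_trans _]]] := de_cong.
  by apply/asboolP/asboolP; apply: de_trans => //; apply: de_sym.
Qed.

Lemma classes_computable_lower_central k : has_malcev_term A ->
  classes_computable (@lower_central A k) (4 * k).+1 (iter k level_size (blowup Q * 2)).
Proof.
move=> [d malcev]; elim: k => [|k IH].
  (* The total relation has one class, so a gate reading no bits suffices. The factor 2 keeps sizes
     above 1, the room an input node needs in [classes_computable_step]. *)
  move=> w a wc; apply: (@computable_of_bits _ _ Q m_big void (fun _ _ => false)) => //.
  by rewrite card_void.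
rewrite mulnS; apply: (classes_computable_step malcev _ _ _ _ _ IH).
- exact: lower_central_congruence.
- exact: lower_central_congruence.
- by move=> x y; apply: commutator_sub_right; apply: lower_central_congruence.
- exact: centralizes_commutator.
- elim: k {IH} => [|k IH] /=; first by rewrite leq_pmull.
  by apply: leq_trans IH _; rewrite /level_size mulnCA !mulnA leq_pmull // !muln_gt0.
Qed.

Lemma acceptance_computable k (S : {set U}) : has_malcev_term A ->
  (forall x y, lower_central k x y <-> x = y :> U) ->
  computable m n (4 * k).+2 (blowup Q * iter k level_size (blowup Q * 2))
    (fun x => acircuit_eval o c (map io x) \in S).
Proof.
move=> malcev nil; have c_gt0 := c_wf.1.
have evE x : acircuit_eval o c (map io x) = node_value x (size c).-1.
  by rewrite /node_value -(size_run (anode_val o (map io x)) c) nth_last.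
apply: (@computable_of_bits _ _ Q m_big U
  (fun a x => `[< lower_central k (node_value x (size c).-1) a >])).
- by rewrite (leq_trans _ double_le) ?leq_addr.
- elim: (k) => [|j IH] /=; first by rewrite muln_gt0.
  by rewrite /level_size !muln_gt0.
- by move=> a; apply: classes_computable_lower_central; rewrite ?prednK.
- move=> x y _ _ xy; rewrite !evE; congr (_ \in S); apply/nil.
  by apply: eq_class => //; apply: lower_central_congruence.
Qed.

Lemma iter_level_size k s :
  iter k level_size s = (blowup Q ^ 3 * (size c).+2) ^ k * s.
Proof.
elim: k => [|k IH] /=; first by rewrite mul1n.
rewrite IH /level_size [(_ * _) ^ k.+1]expnS; move: ((_ * _) ^ k) => P.
by rewrite !expnS expn0 muln1 -!mulnA [(size c).+2 * (blowup Q * _)]mulnCA.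
Qed.

End Levels.

Theorem mainTheorem13 (A : finAlgebra) :
  has_malcev_term A -> nilpotent A ->
  forall L : seq bool -> Prop, nuP A L -> CC0 L.
Proof.
move=> malcev [k nil] L [t [io [S [t_wf [[c [e t_size]] LE]]]]].
pose u := #|carrier A|; pose ar := \max_(s : opsym A) arity s.
(* [Q] dominates the bit counts [ar * u], [u * u] and [u + u]. The factorial exceeds every code and
   is divisible by every group order, as these are at most [u]. *)
pose Q := (ar + u + 2) * u.+1; pose m := (2 ^ Q)`!.
have Q_lt : Q < 2 ^ Q by exact: ltn_expl.
have m_big : 2 ^ Q <= m.
  by rewrite dvdn_leq ?fact_gt0 // dvdn_fact // expn_gt0 leqnn.
have m_dvd f : 0 < f -> f <= u -> f %| m.
  move=> f0 fu; rewrite dvdn_fact // f0 (leq_trans fu) // ltnW //.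
  by apply: leq_ltn_trans Q_lt; rewrite /Q; nia.
have arity_le (s : opsym A) : arity s * u <= Q.
  have : arity s <= ar by exact: leq_bigmax.
  by rewrite /Q; nia.
have square_le : u * u <= Q by rewrite /Q; nia.
have double_le : u + u <= Q by rewrite /Q; nia.
(* For n positive, [c * n ^ e + c + 2] is at most [(2 * c + 2) * n ^ e]; this bounds the factor
   [(size (t n)).+2] of each level. *)
pose B := blowup Q; pose K := B * (B ^ 3 * (2 * c + 2)) ^ k * (B * 2).
pose f x := (0 < size x) && (acircuit_eval (io false) (t (size x)) (map io x) \in S).
have fc n : computable m n (4 * k).+2 (K * n ^ (e * k) + K).+1 f.
  (* [t 0] may be ill-formed, but the empty word is rejected, so a gate reading no bits serves. *)
  have [->|n_gt0] := posnP n.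
    apply: (@computable_leq _ _ 1 _ (B * 1)).
    - by [].
    - rewrite muln1; apply: leqW; apply: leq_trans (leq_addl _ _).
      have P_gt0 : 0 < (B ^ 3 * (2 * c + 2)) ^ k.
        by rewrite expn_gt0 muln_gt0 expn_gt0 addn2.
      by rewrite /K -mulnA leq_pmulr // muln_gt0 P_gt0.
    - apply: (@computable_of_bits _ _ Q m_big void (fun _ _ => false)) => //.
        by rewrite card_void.
      by move=> x y sx sy _; rewrite /f sx sy.
  have := acceptance_computable io (t_wf n n_gt0) m_big m_dvd arity_le square_le double_le
    S malcev nil.
  rewrite iter_level_size => acc; apply: (eq_computable (f := fun x =>
    acircuit_eval (io false) (t n) (map io x) \in S)).
    by move=> x sx; rewrite /f sx n_gt0.
  apply: computable_leq acc => //; apply: leqW; apply: leq_trans (leq_addr _ _).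
  have le_P : (B ^ 3 * (size (t n)).+2) ^ k <= (B ^ 3 * (2 * c + 2)) ^ k * n ^ (e * k).
    rewrite expnM -expnMn -mulnA; case: (k) => // k'; rewrite leq_exp2r // leq_mul2l.
    have := t_size n n_gt0; rewrite /acircuit_size => szN; apply/orP; right.
    have : 0 < n ^ e by rewrite expn_gt0 n_gt0.
    by move: szN; move: (n ^ e) => p; nia.
  rewrite -/B /K; move: le_P; move: (_ ^ k) ((_ + _) ^ k) => P1 P2.
  move: (n ^ (e * k)) (B) => p b le_P.
  have := leq_mul (leqnn (b * (b * 2))) le_P; lia.
have /choice[C CE] n := fc n.
exists m; split; first exact: fact_gt0.
exists C, (4 * k).+2, K, (e * k); split=> [n|]; first by case: (CE n).
split=> [n|]; first by have [_ ] := CE n; rewrite ltnS.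
split=> [n|b]; first by case: (CE n).
have [_ _ _ ->] // := CE (size b).
rewrite LE; split=> [[b0 bS]|/andP[]//]; exact/andP.
Qed.
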